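(* Let $n \geq 8$ be an integer with $n \equiv 0, 1$ or $3 \pmod 4$, and let $H_n$ be the graph obtained from the wheel $W_n$ by deleting one spoke. Then $\mu_s(H_n) \leq \frac{1}{2}(n-3)$ if $n \equiv 1$ or $3 \pmod 4$, and $\mu_s(H_n) \leq \frac{n}{2}$ if $n \equiv 0 \pmod 4$.
   Context: All graphs are finite and simple. For a graph $G$ with $p=|V(G)|$ vertices and $q=|E(G)|$ edges, a super edge-magic labeling is a bijection $f: V(G)\cup E(G)\to\{1,2,\ldots,p+q\}$ with $f(V(G))=\{1,\ldots,p\}$ such that $f(x)+f(xy)+f(y)$ is the same constant for every edge $xy$; $G$ is super edge-magic if it has such a labeling. The super edge-magic deficiency $\mu_s(G)$ is the minimum nonnegative integer $t$ such that $G\cup tK_1$ (disjoint union of $G$ with $t$ isolated vertices) is super edge-magic, or $+\infty$ if no such $t$ exists. The wheel $W_n = C_n + K_1$ has vertex set $\{c, x_1,\ldots,x_n\}$ and edges $cx_i$ ($1\le i\le n$, called spokes) and $x_ix_{i+1}$ ($1\le i\le n-1$) together with $x_nx_1$. Thus $H_n$ has vertex set $\{c,x_1,\ldots,x_n\}$ and edge set $\{cx_i: 2\le i\le n\}\cup\{x_ix_{i+1}:1\le i\le n-1\}\cup\{x_nx_1\}$. *)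

(* Defs.v *)
From HB Require Import structures.
From mathcomp Require Import all_boot all_order all_algebra.
From mathcomp Require Import boolp constructive_ereal.

Set Implicit Arguments.
Unset Strict Implicit.
Unset Printing Implicit Defensive.

Record sgraph := SGraph {
  vertex :> finType;
  adj : rel vertex;
  adj_sym : symmetric adj;
  adj_irr : irreflexive adj }.

Definition edges (G : sgraph) : {set {set G}} :=
  [set [set u.1; u.2] | u : G * G & adj u.1 u.2].

Definition edge (G : sgraph) : finType := {e : {set G} | e \in edges G}.

(* The vertex labels are the values of [f] on [inl], the edge labels its values
   on [inr]. *)
Definition super_edge_magic_labeling (G : sgraph) (f : G + edge G -> nat) :
    Prop :=
  [/\ injective f,
      forall k, (exists z, f z = k) <-> 1 <= k <= #|G| + #|edge G|,
      forall k, (exists v : G, f (inl v) = k) <-> 1 <= k <= #|G|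
    & exists s, forall (x y : G) (e : edge G),
        val e = [set x; y] -> f (inl x) + f (inr e) + f (inl y) = s].

Definition super_edge_magic (G : sgraph) : Prop :=
  exists f : G + edge G -> nat, super_edge_magic_labeling f.

Section DisjointUnion.
Variables G H : sgraph.

Definition dunion_adj (u v : G + H) : bool :=
  match u, v with
  | inl x, inl y => adj x y
  | inr x, inr y => adj x y
  | _, _ => false
  end.

Fact dunion_adj_sym : symmetric dunion_adj.
Proof. by case=> x [] y //=; apply: adj_sym. Qed.

Fact dunion_adj_irr : irreflexive dunion_adj.
Proof. by case=> x /=; apply: adj_irr. Qed.

Definition dunion : sgraph := SGraph dunion_adj_sym dunion_adj_irr.
End DisjointUnion.

Fact edgeless_sym (t : nat) : symmetric (fun _ _ : 'I_t => false).
Proof. by []. Qed.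

Fact edgeless_irr (t : nat) : irreflexive (fun _ _ : 'I_t => false).
Proof. by []. Qed.

Definition edgeless (t : nat) : sgraph :=
  SGraph (@edgeless_sym t) (@edgeless_irr t).

(* [\bar rat] hosts both the value [+oo] and the fraction in the bound; a finite
   deficiency is the image of a natural number. *)
Definition sem_deficiency (G : sgraph) : \bar rat :=
  match pselect (exists t, `[< super_edge_magic (dunion G (edgeless t)) >])
  with
  | left ex_t => ((ex_minn ex_t)%:R)%:E
  | right _ => +oo%E
  end.

Section DeleteEdge.
Variables (G : sgraph) (a b : G).

Definition del_edge_adj (x y : G) : bool :=
  adj x y && ([set x; y] != [set a; b]).

Fact del_edge_sym : symmetric del_edge_adj.
Proof. by move=> x y; rewrite /del_edge_adj adj_sym setUC. Qed.

Fact del_edge_irr : irreflexive del_edge_adj.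
Proof. by move=> x; rewrite /del_edge_adj adj_irr. Qed.

Definition del_edge : sgraph := SGraph del_edge_sym del_edge_irr.
End DeleteEdge.

(* The vertices of the wheel are numbered by 'I_n.+1: 0 is the centre c and
   i, for 1 <= i <= n, is the rim vertex x_i. *)
Section Wheel.
Variable n : nat.

Definition wheel_arc (i j : 'I_n.+1) : bool :=
  [|| (i == 0 :> nat) && (1 <= j <= n),
      (1 <= i <= n.-1) && (j == i.+1 :> nat)
    | (i == n :> nat) && (j == 1 :> nat)].

(* The disequality only matters for n = 1, where x_n x_1 would be a loop. *)
Definition wheel_adj (i j : 'I_n.+1) : bool :=
  (i != j) && (wheel_arc i j || wheel_arc j i).

Fact wheel_adj_sym : symmetric wheel_adj.
Proof. by move=> i j; rewrite /wheel_adj eq_sym orbC. Qed.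

Fact wheel_adj_irr : irreflexive wheel_adj.
Proof. by move=> i; rewrite /wheel_adj eqxx. Qed.

Definition wheel : sgraph := SGraph wheel_adj_sym wheel_adj_irr.

(* The deleted spoke is c x_1. *)
Definition wheel_minus_spoke : sgraph :=
  @del_edge wheel (ord0 : 'I_n.+1) (inord 1 : 'I_n.+1).
End Wheel.

(* Main.v *)
(* It suffices to label the vertices injectively so that the edge sums
   f(x) + f(y) are pairwise distinct and fill an interval: the edge labels are
   then forced, and the unused vertex labels go to the isolated vertices.  The
   centre gets the largest label c and x_2, ..., x_n receive consecutive labels,
   so that the spoke sums fill an interval; the rim sums must fill the n values
   just below it.

   For n = 2m+1, the cycle C_n has a labeling by 1, ..., n with consecutive
   sums, and x_1 = 1 is the vertex without spoke.  For n = 4k, the labels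
   1, ..., 4k-1 go to the path x_2 ... x_n, arranged to run from k to k+1 with
   sums 2k+2, ..., 6k-1: it zigzags from k down to 1, jumps to 4k-1, and zigzags
   down to k+1.  Then x_1 = 5k supplies the two missing sums 6k and 6k+1. *)

Require Import Defs.
From mathcomp Require Import all_boot all_order all_algebra.
From mathcomp Require Import boolp constructive_ereal.
From mathcomp Require Import zify lra.

Set Implicit Arguments.
Unset Strict Implicit.
Unset Printing Implicit Defensive.

(** * Injections into an interval of labels *)

Lemma injective_interval_surj (T : finType) (f : T -> nat) :
  injective f -> (forall x, 1 <= f x <= #|T|) ->
  forall k, (exists x, f x = k) <-> 1 <= k <= #|T|.
Proof.
move=> f_inj fP k; split=> [[x <-] //|/andP[k_gt0 k_le]].
have fpred x : (f x).-1 < #|T| by have := fP x; lia.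
pose h x : 'I_#|T| := Ordinal (fpred x).
have h_inj : injective h.
  by move=> x y /(congr1 val) /= hxy; apply: f_inj; have := fP x; have := fP y; lia.
have h_card : #|'I_#|T| | <= #|T| by rewrite card_ord.
have kP : k.-1 < #|T| by lia.
have /codomP[x /(congr1 val) /= hx] :=
  inj_card_onto h_inj h_card (Ordinal kP).
by exists x; have := fP x; lia.
Qed.

(** Exactly [t] labels are missed by [g]; enumerating them labels the [t] extra points. *)
Lemma injection_extension (T : finType) (t : nat) (g : T -> nat) :
  injective g -> (forall x, 1 <= g x <= #|T| + t) ->
  exists h : T + 'I_t -> nat,
    [/\ injective h, forall z, 1 <= h z <= #|T| + t
      & forall x, h (inl x) = g x].
Proof.
move=> g_inj gP; set N := #|T| + t in gP *.
have gpred x : (g x).-1 < N by have := gP x; lia.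
pose g' x : 'I_N := Ordinal (gpred x).
have g'_inj : injective g'.
  by move=> x y /(congr1 val) /= gxy; apply: g_inj; have := gP x; have := gP y; lia.
pose C := ~: (g' @: T).
have cardC : t = #|C|.
  have := cardsC (g' @: T); rewrite card_imset // card_ord -/C cardT /N -cardT.
  by lia.
pose h (z : T + 'I_t) : nat :=
  match z with
  | inl x => g x
  | inr i => (enum_val (cast_ord cardC i)).+1
  end.
have hC x i : g x <> h (inr i).
  move=> /= gx; have := enum_valP (cast_ord cardC i).
  rewrite inE => /negP; apply; apply/imsetP; exists x => //.
  by apply: val_inj; rewrite /= gx.
exists h; split=> //.
- move=> [x|i] [y|j] //=.
  + by move=> /g_inj ->.
  + by move=> /hC.
  + by move=> /esym /hC.
  + by move=> [] /val_inj /enum_val_inj /cast_ord_inj ->.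
- by case=> [x|i] /=; [apply: gP | have := ltn_ord (enum_val (cast_ord cardC i))].
Qed.

(** * From edge sums to a magic labeling *)

Lemma adj_edges (G : sgraph) (x y : G) : adj x y -> [set x; y] \in edges G.
Proof. by move=> xy; apply/imsetP; exists (x, y); rewrite ?inE. Qed.

Lemma edgesP (G : sgraph) (e : edge G) :
  exists x y, adj x y /\ val e = [set x; y].
Proof.
case: e => e /= /imsetP[[x y]]; rewrite inE /= => xy ->.
by exists x, y.
Qed.

Lemma edge_neq (G : sgraph) (e : edge G) (x y : G) :
  val e = [set x; y] -> x != y.
Proof.
have [u [v [uv ->]]] := edgesP e => uvE; apply/eqP=> xy.
have := cards2 u v; rewrite uvE xy setUid cards1.
by case: eqP uv => // ->; rewrite adj_irr.
Qed.

(* Injectivity of the sums forces distinct indices to give distinct edges, so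
   that [#|I|] is the number of edges. *)
Lemma super_edge_magic_of_sums (G : sgraph) (g : G -> nat) (I : finType)
    (u v : I -> G) (a : nat) :
  injective g -> (forall x, 1 <= g x <= #|G|) ->
  (forall i, adj (u i) (v i)) ->
  (forall x y, adj x y -> exists i, [set x; y] = [set u i; v i]) ->
  injective (fun i => g (u i) + g (v i)) ->
  (forall i, a <= g (u i) + g (v i) < a + #|I|) ->
  super_edge_magic G.
Proof.
move=> g_inj gP uv_adj adj_uv s_inj sP.
(* Summing over the edge as a set avoids choosing an orientation. *)
pose s (e : edge G) := \sum_(x in val e) g x.
have sE (e : edge G) x y : val e = [set x; y] -> s e = g x + g y.
  move=> e_xy; rewrite /s e_xy big_setU1 ?big_set1 //= inE.
  exact: edge_neq e_xy.
pose E i : edge G := exist (fun e => e \in edges G) _ (adj_edges (uv_adj i)).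
have E_sum i : s (E i) = g (u i) + g (v i) by apply: sE.
have E_inj : injective E.
  by move=> i j Eij; apply: s_inj; rewrite /= -!E_sum Eij.
have E_surj e : exists i, e = E i.
  have [x [y [xy eE]]] := edgesP e; have [i xyE] := adj_uv _ _ xy.
  by exists i; apply: val_inj; rewrite eE.
have cardE : #|edge G| = #|I|.
  rewrite -(card_codom E_inj); apply: eq_card => e.
  by have [i ->] := E_surj e; rewrite codom_f.
have s_bound e : a <= s e < a + #|I| by have [i ->] := E_surj e; rewrite E_sum.
have s_edge_inj : injective s.
  move=> e e'; have [i ->] := E_surj e; have [j ->] := E_surj e'.
  by rewrite !E_sum => /s_inj ->.
clearbody s.
pose f (z : G + edge G) : nat :=
  match z with
  | inl x => g x
  (* The magic constant is [#|G| + (a + #|I|)]. As [s e] runs over [a], ..., [a + #|I| - 1], the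
     edge labels run from [#|G| + #|I|] down to [#|G| + 1]. *)
  | inr e => #|G| + (a + #|I|) - s e
  end.
have f_inj : injective f.
  move=> [x|e] [y|e']; rewrite /f.
  - by move=> /g_inj ->.
  - by have := gP x; have := s_bound e'; lia.
  - by have := gP y; have := s_bound e; lia.
  - move=> ee'; have := s_bound e; have := s_bound e' => ? ?.
    by congr inr; apply: s_edge_inj; lia.
exists f; split=> //.
- move=> k; rewrite -card_sum; apply: injective_interval_surj => // -[x|e]; rewrite /f.
  + by have := gP x; rewrite card_sum; lia.
  + by have := s_bound e; rewrite card_sum cardE; lia.
- exact: (@injective_interval_surj G g).
- exists (#|G| + (a + #|I|)) => x y e e_xy; rewrite /f.
  by have := s_bound e; rewrite (sE _ _ _ e_xy); lia.
Qed.

Lemma super_edge_magic_dunion_edgeless (G : sgraph) (t : nat) (g : G -> nat)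
    (I : finType) (u v : I -> G) (a : nat) :
  injective g -> (forall x, 1 <= g x <= #|G| + t) ->
  (forall i, adj (u i) (v i)) ->
  (forall x y, adj x y -> exists i, [set x; y] = [set u i; v i]) ->
  injective (fun i => g (u i) + g (v i)) ->
  (forall i, a <= g (u i) + g (v i) < a + #|I|) ->
  super_edge_magic (dunion G (edgeless t)).
Proof.
move=> g_inj gP uv_adj adj_uv s_inj sP.
have [h [h_inj hP hE]] := injection_extension g_inj gP.
apply: (@super_edge_magic_of_sums (dunion G (edgeless t)) h I
  (fun i => inl (u i)) (fun i => inl (v i)) a) => //.
- by move=> z; rewrite card_sum card_ord.
- move=> [x|?] [y|?] // /adj_uv[i xyE]; exists i.
  have := congr1 (fun A : {set G} =>
    [set (inl z : dunion G (edgeless t)) | z in A]) xyE.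
  by rewrite !imsetU1 !imset_set1.
- by move=> i j; rewrite /= !hE => /s_inj.
- by move=> i; rewrite !hE.
Qed.

Lemma sem_deficiency_le (G : sgraph) (t : nat) (r : rat) :
  super_edge_magic (dunion G (edgeless t)) -> (t%:R <= r)%R ->
  (sem_deficiency G <= r%:E)%E.
Proof.
move=> semG tr; rewrite /sem_deficiency; case: pselect => [ex_t|[]]; last first.
  by exists t; apply/asboolP.
case: ex_minnP => m _ m_min; rewrite lee_fin; apply: (Order.POrderTheory.le_trans _ tr).
by rewrite Num.Theory.ler_nat; apply: m_min; apply/asboolP.
Qed.

(** * Labelings of the wheel minus a spoke *)

Definition rim_next (n i : nat) : nat := if i == n then 1 else i.+1.

(* [b] is the least rim sum, [lo] the least label of x_2, ..., x_n. *)
Lemma wheel_minus_spoke_sem (n t lo b : nat) (lab : nat -> nat) :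
  2 < n ->
  (forall i j, i <= n -> j <= n -> lab i = lab j -> i = j) ->
  (forall i, i <= n -> 1 <= lab i <= n.+1 + t) ->
  (forall i, 2 <= i <= n -> lo <= lab i < lo + n.-1) ->
  (forall i j, 1 <= i <= n -> 1 <= j <= n ->
     lab i + lab (rim_next n i) = lab j + lab (rim_next n j) -> i = j) ->
  (forall i, 1 <= i <= n -> b <= lab i + lab (rim_next n i) < b + n) ->
  b + n = lab 0 + lo ->
  super_edge_magic (dunion (wheel_minus_spoke n) (edgeless t)).
Proof.
move=> n_gt2 lab_inj labP spokeP rim_inj rimP b_eq.
pose G := wheel_minus_spoke n.
(* The left summand indexes the spokes to x_2, ..., x_n, the right one the rim edges. *)
pose u (z : 'I_n.-1 + 'I_n) : G :=
  match z with inl _ => ord0 | inr i => inord i.+1 end.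
pose v (z : 'I_n.-1 + 'I_n) : G :=
  match z with inl i => inord i.+2 | inr i => inord (rim_next n i.+1) end.
have nextP i : 1 <= i <= n -> 1 <= rim_next n i <= n.
  by rewrite /rim_next; case: eqP; lia.
have inordE i : i <= n -> nat_of_ord (inord i : 'I_n.+1) = i.
  by move=> i_le; rewrite inordK.
have uvE z : lab (u z : 'I_n.+1) + lab (v z : 'I_n.+1) =
    match z with
    | inl i => lab 0 + lab i.+2
    | inr i => lab i.+1 + lab (rim_next n i.+1)
    end.
  case: z => i; have i_lt := ltn_ord i; rewrite /u /v !inordE //; try lia.
  by have := nextP i.+1; lia.
have spoke2P (i : 'I_n.-1) : lo <= lab i.+2 < lo + n.-1.
  by apply: spokeP; have := ltn_ord i; lia.
have rim1P (i : 'I_n) : b <= lab i.+1 + lab (rim_next n i.+1) < b + n.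
  by apply: rimP; have := ltn_ord i; lia.
have set_eq2 (x y c d : 'I_n.+1) : [set x; y] = [set c; d] ->
    (x = c \/ x = d) /\ (y = c \/ y = d).
  move=> xyE; have := set21 x y; have := set22 x y; rewrite xyE.
  by move=> /set2P ? /set2P ?.
have arcE (x y : G) : wheel_arc (x : 'I_n.+1) y ->
    [set x; y] != [set (ord0 : 'I_n.+1); inord 1] ->
    exists z, [set x; y] = [set u z; v z].
  have y_le : (y : 'I_n.+1) <= n by rewrite -ltnS.
  rewrite /wheel_arc => /or3P[/andP[/eqP x0 yP]|/andP[xP /eqP yx]|/andP[/eqP xn /eqP y1]] ne.
  (* The spoke ending at x_1 is the deleted one. *)
  - have y_ne1 : (y : 'I_n.+1) != 1 :> nat.
      apply: contraNneq ne => y1; apply/eqP; congr [set _; _]; apply: val_inj => //=.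
      by rewrite inordE //; lia.
    have iP : (y : 'I_n.+1) - 2 < n.-1 by lia.
    exists (inl (Ordinal iP)); congr [set _; _]; apply: val_inj => //=.
    by rewrite inordE; lia.
  - have iP : (x : 'I_n.+1).-1 < n by lia.
    exists (inr (Ordinal iP)); congr [set _; _]; apply: val_inj => /=.
      by rewrite inordE; lia.
    by rewrite /rim_next; case: eqP => ?; rewrite inordE; lia.
  - have iP : n.-1 < n by lia.
    exists (inr (Ordinal iP)); congr [set _; _]; apply: val_inj => /=.
      by rewrite inordE; lia.
    by rewrite /rim_next; case: eqP => ?; rewrite inordE; lia.
apply: (@super_edge_magic_dunion_edgeless G t
  (fun x => lab (x : 'I_n.+1)) _ u v b) => /=.
- by move=> x y /lab_inj xy; apply/val_inj/xy; rewrite -ltnS.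
- by move=> x; rewrite card_ord; apply: labP; rewrite -ltnS.
- move=> [i|i]; have i_lt := ltn_ord i; apply/andP; split.
  + rewrite /= /wheel_adj /wheel_arc -val_eqE /= !inordE; lia.
  + apply/eqP=> /set_eq2[_] [] /(congr1 (@nat_of_ord _)) /=; rewrite !inordE; lia.
  + rewrite /= /wheel_adj /wheel_arc -val_eqE /= /rim_next.
    by case: (i.+1 =P n) => ?; rewrite !inordE; lia.
  (* A rim edge starting at x_1 ends at x_2, as [n > 2], so it avoids the centre. *)
  + apply/eqP=> /set_eq2[] [] /(congr1 (@nat_of_ord _)) /=;
      rewrite /rim_next; case: (i.+1 =P n) => ?; rewrite ?inordE; try lia;
      move=> ? [] /(congr1 (@nat_of_ord _)) /=; rewrite ?inordE; lia.
- move=> x y /andP[/andP[_ /orP[xy|yx]] ne]; first exact: arcE.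
  by have [|z zE] := arcE _ _ yx; rewrite setUC //; exists z.
- move=> z z'; rewrite /= !uvE; case: z z' => [i|i] [j|j].
  + move=> /addnI /lab_inj ij; congr inl; apply: val_inj => /=.
    by have := ltn_ord i; have := ltn_ord j; lia.
  (* Rim sums lie below [b + n = lab 0 + lo], spoke sums do not. *)
  + by have := spoke2P i; have := rim1P j; lia.
  + by have := spoke2P j; have := rim1P i; lia.
  + move=> /rim_inj ij; congr inr; apply: val_inj => /=.
    by have := ltn_ord i; have := ltn_ord j; lia.
- move=> z; rewrite uvE card_sum !card_ord; case: z => i.
  + by have := spoke2P i; lia.
  + by have := rim1P i; lia.
Qed.

(** * The two explicit labelings *)

Definition odd_label (m i : nat) : nat :=
  if i == 0 then (3 * m).+1 else if odd i then i.+1./2 else m.+1 + i./2.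

Definition even_label (k i : nat) : nat :=
  if i == 0 then (6 * k).+1
  else if i == 1 then 5 * k
  else if odd i then (if i < 2 * k then 3 * k else (5 * k).-1) - i./2
  else (if i <= 2 * k then k else 3 * k).+1 - i./2.

(** Odd indices climb through 1, ..., m+1 and even ones through m+2, ..., 2m+1, so each step raises
    the sum by one; the closing edge joins m+1 to 1 and gives the least sum. *)
Lemma odd_label_rim (m i : nat) : 1 <= i <= (2 * m).+1 ->
  odd_label m i + odd_label m (rim_next (2 * m).+1 i) =
    if i == (2 * m).+1 then m.+2 else m.+2 + i.
Proof.
rewrite /odd_label /rim_next => i_bd.
by case: (eqVneq i (2 * m).+1) => i_eq /=; do ?(case: ifP => ? /=); lia.
Qed.

(** The first zigzag has sums 2k+2, ..., 4k-1 and the second 4k+1, ..., 6k-1; the jump from 1 to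
    4k-1, at [i = 2 * k], fills the gap 4k. *)
Lemma even_label_rim (k i : nat) : 0 < k -> 1 <= i <= 4 * k ->
  even_label k i + even_label k (rim_next (4 * k) i) =
    if i == 1 then 6 * k
    else if i == 4 * k then (6 * k).+1
    else if i == 2 * k then 4 * k
    else if i < 2 * k then (4 * k).+1 - i
    else 8 * k - i.
Proof.
rewrite /even_label /rim_next => k_gt0 i_bd.
by case: (eqVneq i (4 * k)) => i_eq /=; do ?(case: ifP => ? /=); lia.
Qed.

Lemma wheel_minus_spoke_sem_odd (m : nat) : 0 < m ->
  super_edge_magic
    (dunion (wheel_minus_spoke (2 * m).+1) (edgeless m.-1)).
Proof.
(* Here [lo] is 2 because x_1 takes label 1. The centre's label 3m+1 equals n+1+t for t = m-1. *)
move=> m_gt0; apply: (@wheel_minus_spoke_sem _ _ 2 m.+2 (odd_label m)).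
- lia.
- by move=> i j i_le j_le; rewrite /odd_label; do ?(case: ifP => ? /=); lia.
- by move=> i i_le; rewrite /odd_label; do ?(case: ifP => ? /=); lia.
- by move=> i i_bd; rewrite /odd_label; do ?(case: ifP => ? /=); lia.
- by move=> i j i_bd j_bd; rewrite !odd_label_rim //; do ?(case: ifP => ? /=); lia.
- by move=> i i_bd; rewrite !odd_label_rim //; do ?(case: ifP => ? /=); lia.
- by rewrite /odd_label /=; lia.
Qed.

Lemma wheel_minus_spoke_sem_even (k : nat) : 0 < k ->
  super_edge_magic (dunion (wheel_minus_spoke (4 * k)) (edgeless (2 * k))).
Proof.
move=> k_gt0.
(* The centre's label 6k+1 equals n+1+t for t = 2k. *)
apply: (@wheel_minus_spoke_sem _ _ 1 (2 * k).+2 (even_label k)).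
- lia.
- by move=> i j i_le j_le; rewrite /even_label; do ?(case: ifP => ? /=); lia.
- by move=> i i_le; rewrite /even_label; do ?(case: ifP => ? /=); lia.
- by move=> i i_bd; rewrite /even_label; do ?(case: ifP => ? /=); lia.
- by move=> i j i_bd j_bd; rewrite !even_label_rim //; do ?(case: ifP => ? /=); lia.
- by move=> i i_bd; rewrite !even_label_rim //; do ?(case: ifP => ? /=); lia.
- by rewrite /even_label /=; lia.
Qed.

Theorem theorem2 (n : nat) (hn : (8 <= n)%N)
    (hmod : [\/ n = 0 %[mod 4], n = 1 %[mod 4] | n = 3 %[mod 4]]) :
  (n = 1 %[mod 4] \/ n = 3 %[mod 4] ->
     (sem_deficiency (wheel_minus_spoke n)
        <= (2^-1 * (n%:R - 3%:R))%R%:E)%E) /\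
  (n = 0 %[mod 4] ->
     (sem_deficiency (wheel_minus_spoke n) <= (n%:R / 2)%R%:E)%E).
Proof.
split=> [n_odd|n_even].
  have [m mE] : exists m, n = (2 * m.+1).+1.
    (* With this shift, [m] itself is (n-3)/2, the number of isolated vertices. *)
    by exists n./2.-1; case: n_odd => n_mod; lia.
  rewrite mE; apply: (sem_deficiency_le (wheel_minus_spoke_sem_odd _)) => //.
  by lra.
have [k kE] : exists k, n = 4 * k by exists (n %/ 4); lia.
have k_gt0 : 0 < k by lia.
rewrite kE; apply: (sem_deficiency_le (wheel_minus_spoke_sem_even k_gt0)).
by lra.
Qed.
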